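(* Let $B$ be a Blaschke product with infinitely many zeros $\{z_n\}_{n=1}^\infty\subset\mathbb{D}\setminus\{0\}$ (each zero repeated according to its multiplicity, ordered by non-decreasing moduli), and suppose that all the zeros lie in a Stolz domain, i.e. there exist $\xi\in\mathbb{T}$ and $C>1$ such that $|1-\overline{\xi}z_n|\le C(1-|z_n|)$ for all $n$. If $$\liminf_{n\rightarrow\infty}\frac{\sum_{|z_j|>|z_n|}(1-|z_j|)}{1-|z_n|}>0,$$ where the sum runs over all indices $j$ with $|z_j|>|z_n|$, then $B$ is a one-component inner function.
   Context: $\mathbb{D}$ is the open unit disc of $\mathbb{C}$ and $\mathbb{T}$ its boundary. An inner function is a bounded analytic function in $\mathbb{D}$ having unimodular radial limits almost everywhere on $\mathbb{T}$. An inner function $\Theta$ is called a one-component inner function if the level set $\Omega_\Theta(\varepsilon)=\{z\in\mathbb{D}:|\Theta(z)|<\varepsilon\}$ is connected for some $\varepsilon\in(0,1)$. For a sequence $\{z_n\}\subset\mathbb{D}\setminus\{0\}$ with $\sum_n(1-|z_n|)<\infty$, the Blaschke product with zeros $\{z_n\}$ is $B(z)=\prod_n\frac{|z_n|}{z_n}\frac{z_n-z}{1-\overline{z}_nz}$, $z\in\mathbb{D}$; each zero is repeated according to its multiplicity and $\{z_n\}$ is ordered by non-decreasing moduli. *)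

(* Defs.v *)
(* The complex plane is R[i], for an arbitrary R : realType. *)
From HB Require Import structures.
From mathcomp Require Import all_boot all_order all_algebra.
From mathcomp Require Import all_real_closed.
From mathcomp Require Import all_classical all_reals all_analysis.

Set Implicit Arguments.
Unset Strict Implicit.
Unset Printing Implicit Defensive.

Import Order.TTheory GRing.Theory Num.Theory.
Import numFieldNormedType.Exports.

Local Open Scope classical_set_scope.
Local Open Scope ring_scope.
Local Open Scope complex_scope.

(* The library puts a topology (that of the modulus) on the regular algebra
   R[i]^o, not on R[i] itself; the two types are convertible. *)

(* The library norm `|z| of R[i] takes values in R[i]; this is the real modulus. *)
Notation cmod := Normc.normc.

Definition unit_disc (R : realType) : set R[i]^o := [set z | cmod z < 1].

Definition cis (R : realType) (t : R) : R[i] := cos t +i* sin t.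

Definition has_unimodular_radial_limit (R : realType)
    (f : R[i]^o -> R[i]^o) (zeta : R[i]) : Prop :=
  exists2 l : R[i]^o, f (r%:C * zeta) @[r --> (1 : R)^'-] --> l & cmod l = 1.

(* Analyticity is complex differentiability at every point: derivable is taken
   here over the field R[i], so h in (f (z + h * 1) - f z) / h is complex.
   The unit circle carries arc length, i.e. the image of Lebesgue measure on
   [0, 2 pi[ under cis. Values of f outside the disc are irrelevant. *)
Definition inner_function (R : realType) (f : R[i]^o -> R[i]^o) : Prop :=
  [/\ forall z, unit_disc z -> derivable f z 1,
      exists M : R, forall z, unit_disc z -> cmod (f z) <= M
    & {ae @lebesgue_measure R, forall t, t \in `[0, 2 * pi[ ->
         has_unimodular_radial_limit f (cis t)}].

Definition level_set (R : realType) (f : R[i]^o -> R[i]^o) (eps : R) :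
    set R[i]^o :=
  [set z | unit_disc z /\ cmod (f z) < eps].

Definition one_component_inner (R : realType) (f : R[i]^o -> R[i]^o) : Prop :=
  inner_function f /\
  exists eps : R, 0 < eps < 1 /\ connected (level_set f eps).

Definition blaschke_factor (R : realType) (a z : R[i]) : R[i] :=
  (cmod a)%:C / a * ((a - z) / (1 - a^* * z)).

Definition blaschke_product (R : realType) (a : nat -> R[i]) (z : R[i]^o) :
    R[i]^o :=
  limn (fun n => (\prod_(k < n) blaschke_factor (a k) z : R[i]^o)).

Definition stolz_domain (R : realType) (xi : R[i]) (C : R) : set R[i] :=
  [set z | cmod z < 1 /\ cmod (1 - xi^* * z) <= C * (1 - cmod z)].

(* The quotient is extended-real valued because its liminf may be +oo. *)
Definition tail_ratio (R : realType) (a : nat -> R[i]) (n : nat) : \bar R :=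
  ((\sum_(j <oo | (cmod (a n) < cmod (a j))%R) (1 - cmod (a j))%:E)
     / (1 - cmod (a n))%:E)%E.

(* Main.v *)
Require Import Defs.
From HB Require Import structures.
From mathcomp Require Import all_boot all_order all_algebra.
From mathcomp Require Import all_real_closed.
From mathcomp Require Import all_classical all_reals all_analysis.
From mathcomp Require Import ring lra.

Set Implicit Arguments.
Unset Strict Implicit.
Unset Printing Implicit Defensive.

Import Order.TTheory GRing.Theory Num.Theory.
Import numFieldNormedType.Exports.

Local Open Scope classical_set_scope.
Local Open Scope ring_scope.
Local Open Scope complex_scope.

(** The zeros cluster only at the point [xi] of the circle. Two elementary facts
    carry the proof.

    The product is inner. On a set of the closed disc that stays away from all
    the poles [1 / conj (a k)], the factors are [1 + O(1 - |a k|)], with slopes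
    and variations of slopes of the same size. Hence the partial products
    converge there, their limit is Lipschitz, and so are its slopes at a fixed
    base point; Lipschitz slopes have a limit, which is the complex
    derivative ([prod_lim_derivable]). Discs of radius less than 1 are such
    sets. So is the closed radius ending at any [zeta <> xi] of the circle,
    because the zeros lie in a Stolz domain at [xi]; the partial products being
    unimodular at [zeta], so is the limit ([blaschke_product_radial_limit]).
    At most one parameter of the circle remains exceptional.

    A level set is connected. The Cayley transform sends the disc to the right
    half-plane and [xi] to 0, the modulus of each factor becomes the
    pseudo-hyperbolic distance [rho] to a zero, and the zeros lie in a bounded
    part of the cone [|v| <= C u]. From any point one can
    walk, first radially towards 0 and then horizontally away from the
    boundary, into a truncated cone [core] while approaching all the zeros at
    once ([hdefect_scale], [hdefect_horizontal]); so [|B|] stays below its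
    value at the start of the walk. On the core itself [|B|] is bounded away
    from 1: the hypothesis on the tails provides, at every height, enough
    zeros of smaller modulus in the half-plane to make the sum of the
    [1 - rho ^ 2] at least a constant [tau] ([core_defect_bound]), whence
    [|B| ^ 2 <= 1 / (1 + tau)] ([blaschke_product_defect_bound]). For [eps]
    between this bound and 1, the level set is made of the convex core
    and of walks that end in it. *)

(** * The modulus and the topology of the complex plane *)

Section ComplexModulus.
Variable R : realType.
Implicit Types (x y z w : R[i]).

Lemma norm_cmod z : `|z| = (cmod z)%:C.
Proof. by rewrite normc_def; case: z. Qed.

Lemma cmod_sqr z : cmod z ^+ 2 = complex.Re z ^+ 2 + complex.Im z ^+ 2.
Proof. by case: z => a b; rewrite /= sqr_sqrtr // addr_ge0 ?sqr_ge0. Qed.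

Lemma cmod_ge0 z : 0 <= cmod z.
Proof. by case: z => a b; exact: sqrtr_ge0. Qed.

Lemma cmodD x y : cmod (x + y) <= cmod x + cmod y.
Proof. exact: (@le_normcD R). Qed.

Lemma cmodN x : cmod (- x) = cmod x.
Proof. exact: normcN. Qed.

Lemma cmodBC x y : cmod (x - y) = cmod (y - x).
Proof. by rewrite -cmodN opprB. Qed.

Lemma cmodM x y : cmod (x * y) = cmod x * cmod y.
Proof. exact: Normc.normcM. Qed.

Lemma cmodV x : cmod x^-1 = (cmod x)^-1.
Proof. exact: Normc.normcV. Qed.

Lemma cmod0 : cmod (0 : R[i]) = 0.
Proof. exact: Normc.normc0. Qed.

Lemma cmod1 : cmod (1 : R[i]) = 1.
Proof. exact: Normc.normc1. Qed.

Lemma cmodJ x : cmod (Num.conj x) = cmod x.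
Proof. by case: x => a b /=; rewrite sqrrN. Qed.

Lemma cmod_real (r : R) : cmod r%:C = `|r|.
Proof. by rewrite /= expr0n addr0 sqrtr_sqr. Qed.

Lemma cmod2 : cmod (2 : R[i]) = 2.
Proof. by rewrite (_ : 2 = (2 : R)%:C) ?cmod_real ?ger0_norm // rmorphMn rmorph1. Qed.

Lemma cmod_gt0 x : (0 < cmod x) = (x != 0).
Proof.
rewrite lt_neqAle cmod_ge0 andbT eq_sym; congr (~~ _).
by apply/eqP/eqP => [/Normc.eq0_normc //|->]; exact: cmod0.
Qed.

Lemma cmod_triangle x y z : cmod (x - z) <= cmod (x - y) + cmod (y - z).
Proof. by rewrite (_ : x - z = (x - y) + (y - z)) ?cmodD //; ring. Qed.

Lemma cmodB x y : cmod (x - y) <= cmod x + cmod y.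
Proof. by rewrite -(cmodN y) cmodD. Qed.

Lemma lerB_cmod x y : cmod x - cmod y <= cmod (x - y).
Proof. by rewrite lerBlDr -{1}(subrK y x) cmodD. Qed.

Lemma cmod_le_ReIm z : cmod z <= `|complex.Re z| + `|complex.Im z|.
Proof.
rewrite -(@ler_pXn2r _ 2) ?nnegrE ?addr_ge0 ?cmod_ge0 // cmod_sqr.
rewrite -(real_normK (num_real (complex.Re z))).
rewrite -(real_normK (num_real (complex.Im z))).
by have := normr_ge0 (complex.Re z); have := normr_ge0 (complex.Im z); nra.
Qed.

Lemma Re_le_cmod z : `|complex.Re z| <= cmod z.
Proof.
rewrite -(@ler_pXn2r _ 2) ?nnegrE ?cmod_ge0 // cmod_sqr.
by rewrite real_normK ?num_real // lerDl sqr_ge0.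
Qed.

Lemma Im_le_cmod z : `|complex.Im z| <= cmod z.
Proof.
rewrite -(@ler_pXn2r _ 2) ?nnegrE ?cmod_ge0 // cmod_sqr.
by rewrite real_normK ?num_real // lerDr sqr_ge0.
Qed.

(** The library norm is [R[i]]-valued, and so are the radii of its balls; a
    positive element of [R[i]] is real, so real radii suffice. *)
Lemma cvg_cmodP (T : Type) (F : set_system T) {FF : Filter F}
    (f : T -> R[i]^o) (l : R[i]^o) :
  f @ F --> l <-> forall e : R, 0 < e -> \forall t \near F, cmod (l - f t) < e.
Proof.
split=> [/cvgrPdist_lt fl e e0|fl].
  have /fl : 0 < e%:C by rewrite ltcR.
  by apply: filterS => t; rewrite norm_cmod ltcR.
apply/cvgrPdist_lt => e e0.
have eE : e = (complex.Re e)%:C by rewrite RRe_real // ger0_real // ltW.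
have /fl : 0 < complex.Re e by rewrite -ltcR -eE.
by apply: filterS => t; rewrite norm_cmod eE ltcR.
Qed.

Lemma cvgn_cmodP (u : nat -> R[i]^o) (l : R[i]^o) :
  u @ \oo --> l <->
  forall e : R, 0 < e -> exists N, forall n, (N <= n)%N -> cmod (l - u n) < e.
Proof.
split=> [/cvg_cmodP ul e /ul[N _ uN]|ul]; first by exists N.
by apply/cvg_cmodP => e /ul[N uN]; exists N.
Qed.

Lemma cauchy_cmod_cvg (u : nat -> R[i]^o) :
  (forall e : R, 0 < e ->
     exists N, forall n, (N <= n)%N -> cmod (u N - u n) <= e) ->
  exists l : R[i]^o, u @ \oo --> l.
Proof.
move=> uC.
have real_cvg (v : nat -> R) :
    (forall m n, `|v m - v n| <= cmod (u m - u n)) -> exists r : R, v @ \oo --> r.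
  move=> vu; suff vC : cauchy (v @ \oo) by exists (limn v); exact: cauchy_cvg.
  apply/cauchyP => e e0; have [|N uN] := uC (e / 2); first by rewrite divr_gt0.
  exists (v N); exists N => // n /= Nn; rewrite /ball /=.
  by have := le_trans (vu N n) (uN _ Nn); lra.
have [|r ur] := real_cvg (fun n => complex.Re (u n)).
  by move=> m n; rewrite -raddfB; exact: Re_le_cmod.
have [|s us] := real_cvg (fun n => complex.Im (u n)).
  by move=> m n; rewrite -raddfB; exact: Im_le_cmod.
exists (r +i* s); apply/cvg_cmodP => e e0.
have e2 : 0 < e / 2 by rewrite divr_gt0.
have /cvgrPdist_lt/(_ _ e2) r2 := ur; have /cvgrPdist_lt/(_ _ e2) s2 := us.
near=> n.
apply: (le_lt_trans (cmod_le_ReIm _)); rewrite (splitr e) ltrD //.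
  by rewrite raddfB /=; near: n.
by rewrite raddfB /=; near: n.
Unshelve. all: by end_near. Qed.

Lemma cmod_lim_le (u : nat -> R[i]^o) (l c : R[i]^o) (M : R) (N : nat) :
  u @ \oo --> l -> (forall n, (N <= n)%N -> cmod (u n - c) <= M) ->
  cmod (l - c) <= M.
Proof.
move=> /cvgn_cmodP ul uM; apply/ler_addgt0Pr => e /ul[K uK].
have h1 := uK (maxn N K) (leq_maxr _ _).
have h2 := uM (maxn N K) (leq_maxl _ _).
have := cmod_triangle l (u (maxn N K)) c; lra.
Qed.

Lemma derivable_cmod (f : R[i]^o -> R[i]^o) (z l : R[i]^o) :
  (forall e : R, 0 < e -> exists2 d : R, 0 < d &
     forall h : R[i], h != 0 -> cmod h < d ->
       cmod (l - (f (z + h) - f z) / h) < e) ->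
  derivable f z 1.
Proof.
move=> fl; apply/cvg_ex; exists l; apply/cvg_cmodP => e /fl[d d0 fd].
apply/nbhs_ballP; exists d%:C => /=; first by rewrite ltcR.
move=> h; rewrite /ball /= sub0r normrN norm_cmod ltcR => hd h0.
by have := fd h h0 hd; rewrite [h%:A]mulr1 (addrC h) [_ *: _]mulrC.
Qed.

(** Only segments and their Moebius images are used as paths below; these are
    Lipschitz. *)
Lemma connected_component_path (A : set R[i]^o) (g : R -> R[i]^o) (L : R) :
  (forall s t, 0 <= s <= 1 -> 0 <= t <= 1 ->
     cmod (g s - g t) <= L * `|s - t|) ->
  (forall t, 0 <= t <= 1 -> A (g t)) ->
  connected_component A (g 0) (g 1).
Proof.
move=> gL gA; exists [set g t | t in `[0, 1]].
  split.
  - by exists 0 => //=; rewrite in_itv /= lexx ler01.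
  - by move=> _ [t + <-]; rewrite /= in_itv /=; exact: gA.
  apply: connected_continuous_connected; first exact: segment_connected.
  apply/subspace_continuousP => s; rewrite /= in_itv /= => s01.
  apply/cvg_cmodP => e e0.
  apply/nbhs_ballP; exists (e / (`|L| + 1)) => /=; first by rewrite divr_gt0 ?ltr_pwDr.
  move=> t; rewrite /ball /= in_itv /= => st t01.
  apply: (le_lt_trans (gL _ _ s01 t01)).
  rewrite ltr_pdivlMr ?ltr_pwDr // in st.
  apply: le_lt_trans st; rewrite mulrC ler_wpM2l // (le_trans (ler_norm L)) //.
  by rewrite lerDl.
by exists 1 => //=; rewrite in_itv /= lexx ler01.
Qed.

(** Components are connected, and a point joined to all others has the whole
    set as its component. *)
Lemma connected_hub (A : set R[i]^o) (p : R[i]^o) :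
  (forall z, A z -> connected_component A z p) -> connected A.
Proof.
move=> Ap; have [[z Az]|/set0P/negP/negPn/eqP ->] := pselect (A !=set0); last first.
  exact: connected0.
have pA : A p by have /connected_component_sub := Ap z Az.
rewrite (_ : A = connected_component A p); first exact: component_connected.
apply/seteqP; split => [x /Ap|]; first exact: connected_component_sym.
exact: connected_component_sub.
Qed.

End ComplexModulus.

(** * Infinite products with summable slopes *)

Section ProductSlopes.
Variable R : realType.
Variables (E : set R[i]) (b : nat -> R[i] -> R[i]) (A : nat -> R) (S : R).
Hypothesis A_ge0 : forall k, 0 <= A k.
Hypothesis A_sum : forall n, \sum_(k < n) A k <= S.
Hypothesis b_le1 : forall k z, E z -> cmod (b k z) <= 1.
Hypothesis b_near1 : forall k z, E z -> cmod (1 - b k z) <= A k.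
Hypothesis b_slope : forall k, exists g : R[i] -> R[i] -> R[i],
  [/\ forall z w, E z -> E w -> b k z - b k w = (z - w) * g z w,
      forall z w, E z -> E w -> cmod (g z w) <= A k
    & forall z z' w, E z -> E z' -> E w ->
        cmod (g z w - g z' w) <= A k * cmod (z - z')].

Let P n z := \prod_(k < n) b k z.

Let sum_ge0 n : 0 <= \sum_(k < n) A k.
Proof. by apply: sumr_ge0. Qed.

Let S_ge0 : 0 <= S.
Proof. by apply: le_trans (A_sum 0); rewrite big_ord0. Qed.

Let prod_le1 n z : E z -> cmod (P n z) <= 1.
Proof.
move=> Ez; rewrite /P; elim: n => [|n IHn]; first by rewrite big_ord0 cmod1.
by rewrite big_ord_recr cmodM mulr_ile1 ?cmod_ge0 ?b_le1.
Qed.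

Lemma prod_near1_cvg z : E z -> exists l : R[i]^o, (P ^~ z : nat -> R[i]^o) @ \oo --> l.
Proof.
move=> Ez.
have step m n : (m <= n)%N ->
    cmod (P m z - P n z) <= \sum_(k < n) A k - \sum_(k < m) A k.
  move=> /subnK <-; elim: (n - m)%N => [|d IHd]; first by rewrite add0n !subrr cmod0.
  rewrite addSn [P _.+1 _]big_ord_recr big_ord_recr /= -/(P _ z).
  apply: (le_trans (cmod_triangle _ (P (d + m) z) _)).
  rewrite addrAC lerD // -{1}(mulr1 (P (d + m) z)) -mulrBr cmodM.
  rewrite -[leRHS]mul1r ler_pM ?cmod_ge0 ?prod_le1 ?b_near1 //.
have Scvg : cvgn (fun n => \sum_(k < n) A k).
  apply: nondecreasing_is_cvgn.
    move=> m n /subnK <-; elim: (n - m)%N => [|d IHd]; first by rewrite add0n.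
    by rewrite addSn big_ord_recr /= (le_trans IHd) // lerDl.
  by exists S => _ [n _ <-].
apply: cauchy_cmod_cvg => e e0.
have /cvgrPdist_lt/(_ (e / 2)) := Scvg; case; first by rewrite divr_gt0.
move=> N _ SN; exists N => n Nn; apply: (le_trans (step _ _ Nn)).
have := SN N (leqnn N); have := SN n Nn; rewrite !ltr_distlC => /andP[h1 h2] /andP[h3 h4].
lra.
Qed.

(** Slopes obey the Leibniz rule
    [(P b)(z) - (P b)(w) = (P(z) - P(w)) b(z) + P(w) (b(z) - b(w))], so that
    a bound on the slopes of the factors and on their variation passes to the
    partial products, uniformly in the number of factors. *)
Lemma prod_slope n : exists G : R[i] -> R[i] -> R[i],
  [/\ forall z w, E z -> E w -> P n z - P n w = (z - w) * G z w,
      forall z w, E z -> E w -> cmod (G z w) <= \sum_(k < n) A k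
    & forall z z' w, E z -> E z' -> E w ->
        cmod (G z w - G z' w) <= (\sum_(k < n) A k) * (1 + S) * cmod (z - z')].
Proof.
elim: n => [|n [G [PG GA GL]]].
  exists (fun _ _ => 0); split=> *; rewrite /P ?big_ord0 ?subrr ?mulr0 ?cmod0 ?mul0r //.
have [g [bg gA gL]] := b_slope n.
exists (fun z w => G z w * b n z + P n w * g z w); split.
- move=> z w Ez Ew; rewrite /P !big_ord_recr /= -/(P n z) -/(P n w).
  rewrite mulrDr mulrA -PG // mulrCA -bg //; ring.
- move=> z w Ez Ew; rewrite big_ord_recr /=; apply: (le_trans (cmodD _ _)).
  rewrite !cmodM; apply: lerD.
    by rewrite -[leRHS]mulr1 ler_pM ?cmod_ge0 ?GA ?b_le1.
  by rewrite -[leRHS]mul1r ler_pM ?cmod_ge0 ?gA ?prod_le1.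
- move=> z z' w Ez Ez' Ew; rewrite big_ord_recr /=.
  rewrite (_ : _ - _ = (G z w - G z' w) * b n z + G z' w * (b n z - b n z')
     + P n w * (g z w - g z' w)); last by ring.
  apply: (le_trans (cmodD _ _)); apply: (le_trans (lerD (cmodD _ _) (lexx _))).
  rewrite bg // !cmodM.
  have T1 : cmod (G z w - G z' w) * cmod (b n z)
      <= (\sum_(k < n) A k) * (1 + S) * cmod (z - z').
    by rewrite -[leRHS]mulr1 ler_pM ?cmod_ge0 ?GL ?b_le1.
  have T2 : cmod (G z' w) * (cmod (z - z') * cmod (g z z'))
      <= S * (cmod (z - z') * A n).
    rewrite ler_pM ?mulr_ge0 ?cmod_ge0 ?(le_trans (GA _ _ Ez' Ew)) //.
    by rewrite ler_wpM2l ?cmod_ge0 ?gA.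
  have T3 : cmod (P n w) * cmod (g z w - g z' w) <= A n * cmod (z - z').
    by rewrite -[leRHS]mul1r ler_pM ?cmod_ge0 ?gL ?prod_le1.
  by apply: (le_trans (lerD (lerD T1 T2) T3)); rewrite le_eqVlt; apply/orP; left; apply/eqP; ring.
Qed.

Variable F : R[i]^o -> R[i]^o.
Hypothesis PF : forall z, E z -> (P ^~ z : nat -> R[i]^o) @ \oo --> F z.

Lemma prod_lim_lipschitz z w :
  E z -> E w -> cmod (F z - F w) <= S * cmod (z - w).
Proof.
move=> Ez Ew; rewrite -[F z - F w]subr0.
apply: (@cmod_lim_le _ (fun n => P n z - P n w : R[i]^o) _ _ _ 0%N).
  by apply: cvgB; exact: PF.
move=> n _; have [G [PG GA _]] := prod_slope n.
by rewrite subr0 PG // cmodM mulrC ler_wpM2r ?cmod_ge0 // (le_trans (GA _ _ Ez Ew)).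
Qed.

(** For [z <> w] the slope of the limit is the limit of the slopes, so the
    uniform estimates of [prod_slope] survive without any reference to
    derivatives of the partial products. *)
Lemma prod_lim_slope_lipschitz z z' w :
  E z -> E z' -> E w -> z != w -> z' != w ->
  cmod ((F z - F w) / (z - w) - (F z' - F w) / (z' - w))
    <= S * (1 + S) * cmod (z - z').
Proof.
move=> Ez Ez' Ew zw z'w; rewrite -[X in cmod X]subr0.
apply: (@cmod_lim_le _ (fun n => (P n z - P n w) / (z - w)
   - (P n z' - P n w) / (z' - w) : R[i]^o) _ _ _ 0%N).
  have slope_cvg x : E x -> (fun n => (P n x - P n w) / (x - w) : R[i]^o) @ \oo -->
      ((F x - F w) / (x - w) : R[i]^o).
    move=> Ex; apply: (@cvgMr_tmp R[i]); apply: cvgB; exact: PF.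
  by apply: cvgB; exact: slope_cvg.
move=> n _; have [G [PG _ GL]] := prod_slope n.
rewrite subr0 !PG // ![_ * _ / _]mulrAC !divff ?subr_eq0 // !mul1r.
apply: (le_trans (GL _ _ _ Ez Ez' Ew)).
by rewrite !ler_wpM2r ?cmod_ge0 ?addr_ge0.
Qed.

(** The slopes at [w], being Lipschitz, form a Cauchy family at [w]: completeness
    applied to one sequence of increments gives the derivative, and the
    Lipschitz bound carries the convergence over to all increments. *)
Lemma prod_lim_derivable w (r : R) :
  0 < r -> (forall z, cmod (z - w) < r -> E z) -> derivable F w 1.
Proof.
move=> r0 rE.
have Ew : E w by apply: rE; rewrite subrr cmod0.
pose L := S * (1 + S) + 1.
have L0 : 0 < L by rewrite ltr_wpDl // mulr_ge0 // addr_ge0.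
have rn0 n : 0 < r / (n.+2)%:R by rewrite divr_gt0 // ltr0n.
(* The shift by two keeps [h 0] strictly inside the ball of radius [r]. *)
pose h n : R[i] := (r / (n.+2)%:R)%:C.
have h0 n : h n != 0 by rewrite -cmod_gt0 cmod_real gtr0_norm.
have hr n : cmod (h n) < r.
  by rewrite cmod_real gtr0_norm // ltr_pdivrMr ?ltr0n // ltr_pMr // ltr1n.
have slopeL k l : k != 0 -> l != 0 -> cmod k < r -> cmod l < r ->
    cmod ((F (w + k) - F w) / k - (F (w + l) - F w) / l) <= L * cmod (k - l).
  move=> k0 l0 kr lr.
  have sub x : w + x - w = x by ring.
  have := @prod_lim_slope_lipschitz (w + k) (w + l) w.
  rewrite !sub (_ : w + k - (w + l) = k - l); last by ring.
  move=> H; apply: (le_trans (H _ _ Ew _ _)).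
  - by apply: rE; rewrite sub.
  - by apply: rE; rewrite sub.
  - by rewrite -subr_eq0 sub.
  - by rewrite -subr_eq0 sub.
  - by rewrite ler_wpM2r ?cmod_ge0 // lerDl.
pose s n : R[i]^o := (F (w + h n) - F w) / h n.
have hsmall e : 0 < e -> exists N, forall n, (N <= n)%N -> cmod (h n) < e.
  move=> e0; exists (Num.truncn (r / e)) => n Nn; rewrite cmod_real gtr0_norm //.
  rewrite ltr_pdivrMr ?ltr0n // mulrC -ltr_pdivrMr //.
  apply: (lt_le_trans (truncnS_gt _)); rewrite ler_nat ltnS.
  exact: leq_trans Nn (leqnSn _).
have [l sl] : exists l : R[i]^o, s @ \oo --> l.
  apply: cauchy_cmod_cvg => e e0.
  have [N hN] := hsmall (e / (2 * L)) (divr_gt0 e0 (mulr_gt0 (ltr0Sn _ 1) L0)).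
  exists N => n Nn; apply: (le_trans (slopeL _ _ (h0 _) (h0 _) (hr _) (hr _))).
  apply: (@le_trans _ _ (L * (e / (2 * L) + e / (2 * L)))).
    rewrite ler_pM2l // (le_trans (cmodB _ _)) // lerD // ltW // hN //.
  by rewrite le_eqVlt; apply/orP; left; apply/eqP; field; rewrite gt_eqF.
apply: (@derivable_cmod _ _ _ l) => e e0.
exists (Num.min r (e / L / 2)); first by rewrite lt_min r0 !divr_gt0.
move=> k k0; rewrite lt_min => /andP[kr ke].
have [N hN] := hsmall (e / L / 2) (divr_gt0 (divr_gt0 e0 L0) (ltr0Sn _ 1)).
have le1 : cmod (l - (F (w + k) - F w) / k) <= L * (cmod k + e / L / 2).
  apply: (@cmod_lim_le _ s _ _ _ N) => // n Nn.
  apply: (le_trans (slopeL _ _ (h0 _) k0 (hr _) kr)).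
  by rewrite ler_pM2l // (le_trans (cmodB _ _)) // addrC lerD // ltW // hN.
apply: (le_lt_trans le1); rewrite mulrC -ltr_pdivlMr //.
by rewrite [ltRHS]splitr ltrD2r.
Qed.

End ProductSlopes.

(** * Blaschke products away from the cluster set of their zeros *)

Section BlaschkeFactor.
Variable R : realType.
Implicit Types (a z w : R[i]).

Lemma one_sub_conjM_gt0 a z : cmod a < 1 -> cmod z <= 1 -> 0 < cmod (1 - a^* * z).
Proof.
move=> a1 z1; apply: lt_le_trans (lerB_cmod _ _).
rewrite cmod1 cmodM cmodJ subr_gt0.
by apply: le_lt_trans a1; rewrite -[leRHS]mulr1 ler_wpM2l ?cmod_ge0.
Qed.

(** The identity behind the invariance of the pseudo-hyperbolic distance; it
    yields both [|b| <= 1] in the disc and [|b| = 1] on the circle. *)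
Lemma cmod_one_sub_conjM_sqr a z :
  cmod (1 - a^* * z) ^+ 2 - cmod (a - z) ^+ 2 =
  (1 - cmod a ^+ 2) * (1 - cmod z ^+ 2).
Proof. by rewrite !cmod_sqr; case: a z => p q [r s] /=; ring. Qed.

Lemma cmod_blaschke_factor a z : a != 0 ->
  cmod (blaschke_factor a z) = cmod (a - z) / cmod (1 - a^* * z).
Proof.
move=> a0; rewrite /blaschke_factor !cmodM !cmodV cmod_real ger0_norm ?cmod_ge0 //.
by rewrite divff ?mul1r // gt_eqF // cmod_gt0.
Qed.

Lemma cmod_blaschke_factor_le1 a z : a != 0 -> cmod a < 1 -> cmod z <= 1 ->
  cmod (blaschke_factor a z) <= 1.
Proof.
move=> a0 a1 z1; rewrite cmod_blaschke_factor // ler_pdivrMr ?one_sub_conjM_gt0 //.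
rewrite mul1r -(@ler_pXn2r _ 2) ?nnegrE ?cmod_ge0 // -subr_ge0.
by rewrite cmod_one_sub_conjM_sqr mulr_ge0 // subr_ge0 expr_le1 ?cmod_ge0 // ltW.
Qed.

Lemma cmod_blaschke_factor_circle a z : a != 0 -> cmod a < 1 -> cmod z = 1 ->
  cmod (blaschke_factor a z) = 1.
Proof.
move=> a0 a1 z1; rewrite cmod_blaschke_factor //.
have d0 : 0 < cmod (1 - a^* * z) by rewrite one_sub_conjM_gt0 ?z1.
suff -> : cmod (a - z) = cmod (1 - a^* * z) by rewrite divff // gt_eqF.
apply/eqP; rewrite -(@eqrXn2 _ 2) ?cmod_ge0 // eq_sym -subr_eq0.
by rewrite cmod_one_sub_conjM_sqr z1 expr1n subrr mulr0.
Qed.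

Lemma sqr_cmodC a : (cmod a)%:C ^+ 2 = a * Num.conj a.
Proof. by rewrite -sqr_normc norm_cmod. Qed.

Variables (a : R[i]) (d : R).
Hypotheses (a0 : a != 0) (a1 : cmod a < 1) (d0 : 0 < d) (d1 : d <= 1).

(* Eliminating the conjugate turns the identities below into field identities
   in [a], its modulus and [z]. *)
Let conjE : Num.conj a = (cmod a)%:C ^+ 2 / a.
Proof. by rewrite sqr_cmodC mulrAC divff // mul1r. Qed.

Let e0 : 0 <= 1 - cmod a. Proof. by rewrite subr_ge0 ltW. Qed.

Let dpow (m n : nat) : (m <= n)%N -> d ^+ n <= d ^+ m.
Proof. by move=> mn; rewrite ler_wiXn2l // ltW. Qed.

Let far_neq0 z : d <= cmod (1 - a^* * z) -> 1 - a^* * z != 0.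
Proof. by move=> h; rewrite -cmod_gt0 (lt_le_trans d0). Qed.

(** [1 - b(z) = (1 - |a|) (a + |a| z) / (a (1 - conj a z))]. The exponent 3 of [d]
    comes from the variation of the slopes below, a product of three inverse
    denominators; since [d <= 1], one bound serves all the estimates. *)
Lemma blaschke_factor_near1 z : cmod z <= 1 -> d <= cmod (1 - a^* * z) ->
  cmod (1 - blaschke_factor a z) <= 2 * (1 - cmod a) / d ^+ 3.
Proof.
move=> z1 dz.
have -> : 1 - blaschke_factor a z =
    (1 - cmod a)%:C * ((1 + (cmod a)%:C / a * z) / (1 - a^* * z)).
  have := far_neq0 dz; rewrite /blaschke_factor rmorphB rmorph1. rewrite conjE => h.
  field; rewrite a0 /= (_ : a - _ = a * (1 - (cmod a)%:C ^+ 2 / a * z)).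
    by rewrite mulf_neq0.
  by field.
rewrite cmodM cmod_real ger0_norm // (mulrC 2) -[leRHS]mulrA ler_wpM2l //.
rewrite cmodM cmodV ler_pM ?invr_ge0 ?cmod_ge0 //.
  apply: (le_trans (cmodD _ _)); rewrite cmod1 !cmodM cmodV cmod_real.
  by rewrite ger0_norm ?cmod_ge0 // divff ?mul1r ?lerD // gt_eqF // cmod_gt0.
rewrite lef_pV2 ?posrE ?exprn_gt0 ?(lt_le_trans d0) //.
by apply: le_trans dz; exact: (@dpow 1 3).
Qed.

(** [b(z) - b(w)] is [z - w] times
    [- (|a| / a) (1 - |a| ^ 2) / ((1 - conj a z) (1 - conj a w))], which is of
    size [1 - |a|] away from the pole. *)
Lemma blaschke_factor_slope : exists g : R[i] -> R[i] -> R[i],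
  [/\ forall z w, d <= cmod (1 - a^* * z) -> d <= cmod (1 - a^* * w) ->
        blaschke_factor a z - blaschke_factor a w = (z - w) * g z w,
      forall z w, d <= cmod (1 - a^* * z) -> d <= cmod (1 - a^* * w) ->
        cmod (g z w) <= 2 * (1 - cmod a) / d ^+ 3
    & forall z z' w, d <= cmod (1 - a^* * z) -> d <= cmod (1 - a^* * z') ->
        d <= cmod (1 - a^* * w) ->
        cmod (g z w - g z' w) <= 2 * (1 - cmod a) / d ^+ 3 * cmod (z - z')].
Proof.
pose k := - ((cmod a)%:C / a * (1 - a * Num.conj a)).
have cmodk : cmod k <= 2 * (1 - cmod a).
  rewrite cmodN !cmodM cmodV cmod_real ger0_norm ?cmod_ge0 //.
  rewrite divff ?gt_eqF ?cmod_gt0 // mul1r -sqr_cmodC.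
  rewrite (_ : 1 - _ = ((1 - cmod a) * (1 + cmod a))%:C); last first.
    by rewrite rmorphM rmorphB rmorphD rmorph1; ring.
  have e1 : 0 <= 1 + cmod a by rewrite addr_ge0 ?cmod_ge0.
  rewrite cmod_real ger0_norm ?mulr_ge0 // mulrC ler_wpM2r //.
  by rewrite lerD2l ltW.
have inv_le z : d <= cmod (1 - a^* * z) -> cmod (1 - a^* * z)^-1 <= d^-1.
  by move=> h; rewrite cmodV lef_pV2 ?posrE // (lt_le_trans d0).
exists (fun z w => k * ((1 - a^* * z)^-1 * (1 - a^* * w)^-1)); split.
- move=> z w /far_neq0 z0 /far_neq0 w0; rewrite /blaschke_factor /k.
  by field; rewrite a0 z0 w0.
- move=> z w hz hw; rewrite cmodM ler_pM ?cmod_ge0 // cmodM.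
  apply: (@le_trans _ _ (d^-1 * d^-1)); first by rewrite ler_pM ?cmod_ge0 ?inv_le.
  by rewrite -invfM -expr2 lef_pV2 ?posrE ?exprn_gt0 // dpow.
- move=> z z' w hz hz' hw.
  rewrite (_ : _ - _ = k * ((1 - a^* * z)^-1 * (1 - a^* * z')^-1 * (1 - a^* * w)^-1)
     * (Num.conj a * (z - z'))); last first.
    have := far_neq0 hz; have := far_neq0 hz'; have := far_neq0 hw => h1 h2 h3.
    by field; rewrite h1 h2 h3.
  rewrite cmodM ler_pM ?cmod_ge0 //; last first.
    by rewrite cmodM cmodJ -[leRHS]mul1r ler_wpM2r ?cmod_ge0 // ltW.
  rewrite cmodM ler_pM ?cmod_ge0 // !cmodM exprSr expr2 !invfM.
  by rewrite !ler_pM ?mulr_ge0 ?cmod_ge0 ?inv_le.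
Qed.

End BlaschkeFactor.

Section BlaschkeProduct.
Variables (R : realType) (a : nat -> R[i]).
Hypothesis a_disc : forall n, unit_disc (a n).
Hypothesis a_neq0 : forall n, a n != 0.
Hypothesis a_blaschke : (\sum_(n <oo) (1 - cmod (a n))%:E < +oo)%E.

Let e_ge0 k : 0 <= 1 - cmod (a k).
Proof. by rewrite subr_ge0 ltW //; exact: a_disc. Qed.

Lemma blaschke_sum_bound : exists S, forall n, \sum_(k < n) (1 - cmod (a k)) <= S.
Proof.
have nn n : (0 <= n)%N -> true -> (0 <= (1 - cmod (a n))%:E)%E by rewrite lee_fin.
exists (fine (\sum_(n <oo) (1 - cmod (a n))%:E)) => n.
rewrite -lee_fin fineK; last first.
  by rewrite ge0_fin_numE // nneseries_ge0.
by rewrite -sumEFin -(big_mkord xpredT (fun k => (1 - cmod (a k))%:E)) nneseries_lim_ge.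
Qed.

(** The bound is on the denominators of the factors. Points of the circle are
    allowed, so that radial limits and analyticity in the disc are treated
    together. *)
Definition far_from_poles (d : R) : set R[i] :=
  [set z | cmod z <= 1 /\ forall k, d <= cmod (1 - (a k)^* * z)].

Section Far.
Variable d : R.
Hypotheses (d0 : 0 < d) (d1 : d <= 1).

Let A k := 2 * (1 - cmod (a k)) / d ^+ 3.

Let A_ge0 k : 0 <= A k.
Proof. by rewrite divr_ge0 ?mulr_ge0 ?exprn_ge0 // ltW. Qed.

Let A_sum : exists S, forall n, \sum_(k < n) A k <= S.
Proof.
have [S aS] := blaschke_sum_bound; exists (2 / d ^+ 3 * S) => n.
rewrite (eq_bigr (fun k : 'I_n => 2 / d ^+ 3 * (1 - cmod (a k)))).
  by rewrite -mulr_sumr; apply: ler_wpM2l (aS n); rewrite divr_ge0 ?exprn_ge0 // ltW.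
by move=> k _; rewrite /A mulrAC.
Qed.

Let b_le1 k z : far_from_poles d z -> cmod (blaschke_factor (a k) z) <= 1.
Proof. by case=> z1 _; exact: cmod_blaschke_factor_le1 (a_disc k) z1. Qed.

Let b_near1 k z : far_from_poles d z -> cmod (1 - blaschke_factor (a k) z) <= A k.
Proof. by case=> z1 /(_ k); apply: blaschke_factor_near1 => //; exact: a_disc. Qed.

Let b_slope k : exists g : R[i] -> R[i] -> R[i],
  [/\ forall z w, far_from_poles d z -> far_from_poles d w ->
        blaschke_factor (a k) z - blaschke_factor (a k) w = (z - w) * g z w,
      forall z w, far_from_poles d z -> far_from_poles d w -> cmod (g z w) <= A k
    & forall z z' w, far_from_poles d z -> far_from_poles d z' ->
        far_from_poles d w -> cmod (g z w - g z' w) <= A k * cmod (z - z')].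
Proof.
have [g [g1 g2 g3]] := blaschke_factor_slope (a_neq0 k) (a_disc k) d0 d1.
exists g; split=> [z w [_ hz] [_ hw]|z w [_ hz] [_ hw]|z z' w [_ hz] [_ hz'] [_ hw]].
- exact: g1.
- exact: g2.
- exact: g3.
Qed.

Lemma blaschke_product_cvg_far z : far_from_poles d z ->
  (fun n => \prod_(k < n) blaschke_factor (a k) z : R[i]^o) @ \oo
    --> blaschke_product a z.
Proof.
move=> dz; have [S AS] := A_sum.
have [l zl] := prod_near1_cvg A_ge0 AS b_le1 b_near1 dz.
rewrite /blaschke_product.
by rewrite (cvg_lim (@norm_hausdorff _ _) zl).
Qed.

Lemma blaschke_product_lipschitz_far : exists L, forall z w,
  far_from_poles d z -> far_from_poles d w ->
  cmod (blaschke_product a z - blaschke_product a w) <= L * cmod (z - w).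
Proof.
have [S AS] := A_sum; exists S => z w dz dw.
exact: (prod_lim_lipschitz AS b_le1 b_slope blaschke_product_cvg_far).
Qed.

Lemma blaschke_product_derivable_far w r : 0 < r ->
  (forall z, cmod (z - w) < r -> far_from_poles d z) ->
  derivable (blaschke_product a) w 1.
Proof.
move=> r0 rd; have [S AS] := A_sum.
exact: (prod_lim_derivable AS b_le1 b_slope blaschke_product_cvg_far r0 rd).
Qed.

End Far.

Lemma far_disc z : cmod z < 1 -> far_from_poles (1 - cmod z) z.
Proof.
move=> z1; split=> [|k]; first exact: ltW.
apply: le_trans (lerB_cmod _ _); rewrite cmod1 lerD2l lerN2 cmodM cmodJ.
by rewrite ler_piMl ?cmod_ge0 // ltW //; exact: a_disc.
Qed.

Lemma blaschke_product_cvg z : cmod z < 1 ->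
  (fun n => \prod_(k < n) blaschke_factor (a k) z : R[i]^o) @ \oo
    --> blaschke_product a z.
Proof.
move=> z1; apply: (@blaschke_product_cvg_far (1 - cmod z)) (far_disc z1).
  by rewrite subr_gt0.
by rewrite lerBlDr lerDl cmod_ge0.
Qed.

Lemma cmod_blaschke_prod_le1 n z : cmod z <= 1 ->
  cmod (\prod_(k < n) blaschke_factor (a k) z) <= 1.
Proof.
move=> z1; elim: n => [|n IHn]; first by rewrite big_ord0 cmod1.
rewrite big_ord_recr cmodM mulr_ile1 ?cmod_ge0 //.
exact: cmod_blaschke_factor_le1 (a_disc n) z1.
Qed.

Lemma blaschke_product_le1 z : cmod z < 1 -> cmod (blaschke_product a z) <= 1.
Proof.
move=> z1; rewrite -[X in cmod X]subr0.
apply: (cmod_lim_le (N := 0%N) (blaschke_product_cvg z1)) => n _.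
by rewrite subr0 cmod_blaschke_prod_le1 // ltW.
Qed.

Lemma blaschke_product_derivable z : cmod z < 1 ->
  derivable (blaschke_product a) z 1.
Proof.
move=> z1; have r0 : 0 < (1 - cmod z) / 2 by rewrite divr_gt0 // subr_gt0.
apply: (blaschke_product_derivable_far r0 _ r0).
  by have := cmod_ge0 z; lra.
move=> w wz; have zw : cmod w < 1 - (1 - cmod z) / 2.
  by have := cmodD (w - z) z; rewrite subrK; lra.
have [w1 wk] : far_from_poles (1 - cmod w) w by apply: far_disc; lra.
by split=> // k; apply: le_trans (wk k); lra.
Qed.

(** Along a radius whose end stays away from the poles the partial products
    are uniformly Lipschitz, end point included, where they are unimodular. *)
Lemma blaschke_product_radial_limit zeta d : cmod zeta = 1 -> 0 < d -> d <= 1 ->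
  (forall r, 0 <= r <= 1 -> far_from_poles d (r%:C * zeta)) ->
  has_unimodular_radial_limit (blaschke_product a) zeta.
Proof.
move=> z1 d0 d1 zd.
have zetad : far_from_poles d zeta.
  by rewrite -[zeta]mul1r; apply: (zd 1); rewrite ler01 lexx.
have [L BL] := blaschke_product_lipschitz_far d0 d1.
exists (blaschke_product a zeta).
  apply/cvg_cmodP => e e0.
  have L0 : 0 < `|L| + 1 by rewrite ltr_pwDr.
  have q0 : 0 < Num.min 1 (e / (`|L| + 1)) by rewrite lt_min ltr01 divr_gt0.
  exists (Num.min 1 (e / (`|L| + 1))) => //= r; rewrite /ball /= lt_min => /andP[r1 re] rlt1.
  have r01 : 0 <= r <= 1 by move: r1; rewrite ltr_norml; lra.
  apply: (le_lt_trans (BL _ _ zetad (zd r r01))).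
  rewrite -{1}[zeta]mul1r -mulrBl cmodM z1 mulr1 (_ : 1 - r%:C = (1 - r)%:C); last first.
    by rewrite rmorphB rmorph1.
  rewrite cmod_real; rewrite ltr_pdivlMr // in re.
  apply: le_lt_trans re; rewrite mulrC ler_wpM2l // (le_trans (ler_norm L)) //.
  by rewrite lerDl.
have prod1 n : cmod (\prod_(k < n) blaschke_factor (a k) zeta) = 1.
  elim: n => [|n IHn]; first by rewrite big_ord0 cmod1.
  rewrite big_ord_recr cmodM IHn mul1r.
  exact: cmod_blaschke_factor_circle (a_disc n) z1.
have /cvgn_cmodP lim := blaschke_product_cvg_far d0 d1 zetad.
apply/eqP; rewrite -subr_eq0 -normr_le0; apply/ler_addgt0Pr => e /lim[N lN].
have := lN N (leqnn N); rewrite add0r => h; have := prod1 N.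
set p := \prod_(k < N) _ in h * => p1.
have h1 := lerB_cmod (blaschke_product a zeta) p.
have h2 := lerB_cmod p (blaschke_product a zeta).
by rewrite cmodBC in h2; rewrite ler_norml; apply/andP; split; lra.
Qed.

End BlaschkeProduct.

(** * Radial limits on the circle *)

Section InnerFunction.
Variable R : realType.

Lemma cmod_cis (t : R) : cmod (cis t) = 1.
Proof. by rewrite /= cos2Dsin2 sqrtr1. Qed.

Lemma cis_inj (s t : R) : 0 <= s < 2 * pi -> 0 <= t < 2 * pi ->
  cis s = cis t -> s = t.
Proof.
wlog st : s t / s <= t => [wl hs ht E|].
  by case: (leP s t) => [|/ltW] h; [|apply/esym]; apply: wl.
move=> /andP[s0 s1] /andP[t0 t1] [cE sE]; apply/eqP; rewrite eq_le st /=.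
rewrite leNgt; apply/negP => lt_st.
have : cos (t - s) = 1 by rewrite cosB cE sE -!expr2 cos2Dsin2.
rewrite (splitr (t - s)) cosD -!expr2 cos2sin2.
have : 0 < sin ((t - s) / 2) by apply: sin_gt0_pi; apply/andP; split; lra.
nra.
Qed.

Lemma cmod_one_sub_conjM_circle (w z : R[i]) : cmod w = 1 \/ cmod z = 1 ->
  cmod (1 - w^* * z) = cmod (w - z).
Proof.
move=> wz1; apply/eqP; rewrite -(@eqrXn2 _ 2) ?cmod_ge0 // -subr_eq0.
rewrite cmod_one_sub_conjM_sqr mulf_eq0 !subr_eq0.
by case: wz1 => ->; rewrite expr1n eqxx ?orbT.
Qed.

Variables (a : nat -> R[i]) (xi : R[i]) (C : R).
Hypothesis a_disc : forall n, unit_disc (a n).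
Hypothesis a_neq0 : forall n, a n != 0.
Hypothesis a_blaschke : (\sum_(n <oo) (1 - cmod (a n))%:E < +oo)%E.
Hypothesis xi1 : cmod xi = 1.
Hypothesis C1 : 1 < C.
Hypothesis a_stolz : forall n, stolz_domain xi C (a n).

(** Since [|xi - a k| <= C (1 - |a k|) <= C |a k - zeta|], one has
    [|xi - zeta| <= (C + 1) |a k - zeta|]; along the radius the denominator
    is at least half of its value [|a k - zeta|] at the end point. *)
Lemma stolz_far_radius zeta r : cmod zeta = 1 -> 0 <= r <= 1 ->
  far_from_poles a (cmod (xi - zeta) / (2 * (C + 1))) (r%:C * zeta).
Proof.
move=> z1 /andP[r0 r1].
have rz : cmod (r%:C * zeta) <= 1 by rewrite cmodM z1 mulr1 cmod_real ger0_norm.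
split=> // k.
have [ak1] := a_stolz k.
rewrite cmod_one_sub_conjM_circle; last by left.
move=> akC.
have t1 := cmod_triangle xi (a k) zeta.
have t2 := lerB_cmod zeta (a k); rewrite z1 cmodBC in t2.
have t3 : cmod (a k - zeta) <= cmod (1 - (a k)^* * (r%:C * zeta)) + (1 - r).
  rewrite -cmod_one_sub_conjM_circle; last by right.
  rewrite (_ : 1 - (a k)^* * zeta = (1 - (a k)^* * (r%:C * zeta))
             - (1 - r)%:C * ((a k)^* * zeta)); last by rewrite rmorphB rmorph1; ring.
  apply: (le_trans (cmodB _ _)); rewrite lerD2l !cmodM z1 mulr1 cmodJ.
  rewrite cmod_real ger0_norm ?subr_ge0 //.
  by rewrite ler_piMr ?subr_ge0 // ltW.
have t4 : 1 - r <= cmod (1 - (a k)^* * (r%:C * zeta)).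
  apply: le_trans (lerB_cmod _ _).
  rewrite cmod1 lerD2l lerN2 !cmodM z1 mulr1 cmodJ cmod_real ger0_norm //.
  by rewrite ler_piMl // ltW.
rewrite ler_pdivrMr ?mulr_gt0 ?addr_gt0 // ?(lt_trans _ C1) //.
have C0 : 0 < C := lt_trans ltr01 C1.
have t5 := ler_wpM2l (ltW C0) t2.
have t6 : cmod (a k - zeta) <= 2 * cmod (1 - (a k)^* * (r%:C * zeta)) by lra.
by have := ler_wpM2l (ltW C0) t6; lra.
Qed.

(** Every point of the circle other than [xi] has a unimodular radial limit, and [cis] takes
    the value [xi] at most once in a period. *)
Lemma blaschke_product_inner : inner_function (blaschke_product a).
Proof.
split.
- by move=> z z1; exact: blaschke_product_derivable.
- by exists 1 => z z1; exact: blaschke_product_le1.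
have radial t : cis t != xi -> has_unimodular_radial_limit (blaschke_product a) (cis t).
  move=> txi; have c0 : 0 < cmod (xi - cis t) by rewrite cmod_gt0 subr_eq0 eq_sym.
  apply: (@blaschke_product_radial_limit _ _ a_disc a_neq0 a_blaschke _
    (cmod (xi - cis t) / (2 * (C + 1)))).
  - exact: cmod_cis.
  - by rewrite divr_gt0 // mulr_gt0 // addr_gt0 // (lt_trans _ C1).
  - have D0 : 0 < 2 * (C + 1) by have := C1; lra.
    by rewrite ler_pdivrMr // (le_trans (cmodB _ _)) // xi1 cmod_cis; have := C1; lra.
  - by move=> r; apply: stolz_far_radius; exact: cmod_cis.
have [[t0 [t0I t0xi]]|noxi] := pselect (exists t, (t \in `[0, 2 * pi[%R) /\ cis t = xi).
  exists [set t0]; split; [exact: measurable_set1|exact: lebesgue_measure_set1|].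
  move=> t /= /not_implyP[tI trad]; apply: cis_inj.
  - by move: tI; rewrite in_itv.
  - by move: t0I; rewrite in_itv.
  - by rewrite t0xi; apply/eqP/negPn/negP => /radial.
exists set0; split; [exact: measurable0|exact: measure0|].
move=> t /= /not_implyP[tI trad]; apply: noxi; exists t; split=> //.
by apply/eqP/negPn/negP => /radial.
Qed.

End InnerFunction.

(** * The half-plane model and the defect of a factor *)

Section HalfPlane.
Variable R : realType.

Implicit Types (w z alpha xi : R[i]) (x y : R).

Definition cayley (w : R[i]) : R[i] := (1 - w) / (1 + w).

(** [1 - rho ^ 2], where [rho] is the pseudo-hyperbolic distance from
    [x + i y] to [alpha] in the right half-plane. *)
Definition hdefect (alpha : R[i]) (x y : R) : R :=
  4 * x * complex.Re alpha /
  ((x + complex.Re alpha) ^+ 2 + (y - complex.Im alpha) ^+ 2).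

Lemma two_neq0 : (2 : R[i]) != 0.
Proof. by rewrite pnatr_eq0. Qed.

Lemma cayleyD1_neq0 w : 1 + w != 0 -> 1 + cayley w != 0.
Proof.
move=> w1; rewrite (_ : 1 + cayley w = 2 / (1 + w)); last by rewrite /cayley; field.
by rewrite mulf_neq0 ?invr_eq0 ?two_neq0.
Qed.

Lemma cayleyK w : 1 + w != 0 -> cayley (cayley w) = w.
Proof.
move=> w1; have := cayleyD1_neq0 w1; rewrite {2}/cayley => h.
rewrite /cayley; field.
by rewrite w1 (_ : 1 + w + (1 - w) = 2) ?two_neq0 //; ring.
Qed.

Lemma one_sub_cmod_cayley_sqr w : 1 + w != 0 ->
  1 - cmod (cayley w) ^+ 2 = 4 * complex.Re w / cmod (1 + w) ^+ 2.
Proof.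
move=> w1; have c1 : cmod (1 + w) ^+ 2 != 0 by rewrite expf_neq0 // gt_eqF // cmod_gt0.
rewrite /cayley cmodM cmodV exprMn exprVn.
rewrite (_ : 4 * complex.Re w = cmod (1 + w) ^+ 2 - cmod (1 - w) ^+ 2).
  by rewrite mulrBl divff.
by rewrite !cmod_sqr; case: (w) => x y /=; ring.
Qed.

Lemma one_add_neq0 w : 0 < complex.Re w -> 1 + w != 0.
Proof.
move=> w0; apply/eqP => /(congr1 (@complex.Re R)) /=; case: w w0 => x y /= x0 h.
by lra.
Qed.

Lemma one_le_cmod_one_add w : 0 <= complex.Re w -> 1 <= cmod (1 + w).
Proof.
move=> w0; apply: le_trans (Re_le_cmod _); apply: le_trans (ler_norm _).
by case: w w0 => x y /= x0; lra.
Qed.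

Lemma cmod_cayley_lt1 w : 0 < complex.Re w -> cmod (cayley w) < 1.
Proof.
move=> w0; rewrite -(@ltr_pXn2r _ 2) ?nnegrE ?cmod_ge0 // expr1n -subr_gt0.
rewrite one_sub_cmod_cayley_sqr ?one_add_neq0 //.
by rewrite divr_gt0 ?mulr_gt0 ?exprn_gt0 ?cmod_gt0 ?one_add_neq0.
Qed.

Lemma disc_one_add_neq0 z : cmod z < 1 -> 1 + z != 0.
Proof.
move=> z1; rewrite -cmod_gt0; have := lerB_cmod (1 : R[i]) (- z).
by rewrite opprK cmodN cmod1 => h; lra.
Qed.

Lemma Re_cayley_gt0 z : cmod z < 1 -> 0 < complex.Re (cayley z).
Proof.
move=> z1; have h := disc_one_add_neq0 z1; have h' := cayleyD1_neq0 h.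
have := one_sub_cmod_cayley_sqr h'; rewrite cayleyK // => E.
have : 0 < 1 - cmod z ^+ 2 by rewrite subr_gt0 expr_lt1 ?cmod_ge0.
rewrite E pmulr_lgt0 ?invr_gt0 ?exprn_gt0 ?cmod_gt0 //.
by rewrite pmulr_rgt0.
Qed.

Lemma cayley_lipschitz w w' : 0 <= complex.Re w -> 0 <= complex.Re w' ->
  cmod (cayley w - cayley w') <= 2 * cmod (w - w').
Proof.
move=> w0 w'0; have h := one_le_cmod_one_add w0; have h' := one_le_cmod_one_add w'0.
have n1 : 1 + w != 0 by rewrite -cmod_gt0 (lt_le_trans _ h).
have n2 : 1 + w' != 0 by rewrite -cmod_gt0 (lt_le_trans _ h').
rewrite (_ : cayley w - cayley w' = - 2 * (w - w') * ((1 + w)^-1 * (1 + w')^-1)); last first.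
  by rewrite /cayley; field; rewrite n1 n2.
rewrite !cmodM cmodN !cmodV cmod2.
rewrite -[leRHS]mulr1 ler_wpM2l ?mulr_ge0 ?cmod_ge0 //.
by rewrite mulr_ile1 ?invr_ge0 ?cmod_ge0 // invf_le1 // (lt_le_trans ltr01).
Qed.

(** The Cayley transform is an isometry from the pseudo-hyperbolic metric of
    the disc to the one of the half-plane, and so is the rotation [xi]. *)
Lemma cmod_blaschke_factor_cayley xi alpha x y :
  cmod xi = 1 -> 0 < complex.Re alpha -> 0 < x -> xi * cayley alpha != 0 ->
  cmod (blaschke_factor (xi * cayley alpha) (xi * cayley (x +i* y))) ^+ 2
    = 1 - hdefect alpha x y.
Proof.
move=> xi1 al0 x0 a0; set w := x +i* y.
have w0 : 0 < complex.Re w by [].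
rewrite cmod_blaschke_factor // expr_div_n.
have E := cmod_one_sub_conjM_sqr (xi * cayley alpha) (xi * cayley w).
have n1 := one_add_neq0 al0; have n2 := one_add_neq0 w0.
have n3 : 1 + alpha^* != 0.
  by rewrite (_ : 1 + alpha^* = Num.conj (1 + alpha)) ?conjC_eq0 // rmorphD rmorph1.
have xixi : Num.conj xi * xi = 1.
  by rewrite mulrC -sqr_cmodC xi1 rmorph1 expr1n.
have c1 : cmod (1 + alpha^*) = cmod (1 + alpha).
  by rewrite -(cmodJ (1 + alpha)) rmorphD rmorph1.
rewrite !(cmodM xi) xi1 !mul1r !one_sub_cmod_cayley_sqr // in E.
have F : 1 - (xi * cayley alpha)^* * (xi * cayley w) =
   2 * (w + alpha^*) / ((1 + alpha^*) * (1 + w)).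
  rewrite rmorphM mulrACA xixi mul1r /cayley.
  rewrite rmorphM fmorphV rmorphB rmorphD rmorph1.
  by field; rewrite n2 n3.
have G : cmod (w + alpha^*) ^+ 2 = (x + complex.Re alpha) ^+ 2 + (y - complex.Im alpha) ^+ 2.
  by rewrite cmod_sqr; case: (alpha).
have D0 : 0 < cmod (w + alpha^*) ^+ 2.
  by rewrite G ltr_pwDl ?sqr_ge0 // exprn_gt0 // addr_gt0.
have q1 : cmod (1 + alpha) != 0 by rewrite gt_eqF // cmod_gt0.
have q2 : cmod (1 + w) != 0 by rewrite gt_eqF // cmod_gt0.
have q3 : cmod (w + alpha^*) != 0.
  by apply/eqP => h; rewrite h expr0n ltxx in D0.
rewrite F in E *.
have N2 (p q r : R) : p - q = r -> q = p - r by move=> <-; ring.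
move/N2: E => ->; rewrite !(cmodM, cmodV) c1 cmod2 /hdefect -G.
rewrite (_ : complex.Re w = x) //. by field; rewrite q1 q2 q3.
Qed.

Lemma hdefect_ge0 alpha x y : 0 < complex.Re alpha -> 0 < x -> 0 <= hdefect alpha x y.
Proof.
by move=> h x0; rewrite divr_ge0 ?mulr_ge0 ?addr_ge0 ?sqr_ge0 // ltW.
Qed.

Lemma hdefect_le alpha x y x' y' : 0 < complex.Re alpha -> 0 < x -> 0 < x' ->
  x * ((x' + complex.Re alpha) ^+ 2 + (y' - complex.Im alpha) ^+ 2) <=
  x' * ((x + complex.Re alpha) ^+ 2 + (y - complex.Im alpha) ^+ 2) ->
  hdefect alpha x y <= hdefect alpha x' y'.
Proof.
move=> al0 x0 x'0 h; rewrite /hdefect.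
have D0 s t : 0 < s -> 0 < (s + complex.Re alpha) ^+ 2 + (t - complex.Im alpha) ^+ 2.
  by move=> s0; rewrite ltr_pwDl ?sqr_ge0 // exprn_gt0 // addr_gt0.
rewrite ler_pdivrMr ?D0 // [leRHS]mulrAC ler_pdivlMr ?D0 //.
have al4 : 0 <= 4 * complex.Re alpha by rewrite mulr_ge0 // ltW.
by have := ler_wpM2l al4 h; lra.
Qed.

(** In the ratio [4 x u / |w + conj alpha| ^ 2], scaling [w] by [s] replaces
    [|w| ^ 2 + |alpha| ^ 2] by [s |w| ^ 2 + |alpha| ^ 2 / s], which is not larger
    as long as [s |w| >= |alpha|]. *)
Lemma hdefect_scale alpha x y r s : 0 < complex.Re alpha -> 0 < x ->
  0 < s <= 1 -> cmod alpha <= r -> r <= s * cmod (x +i* y) ->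
  hdefect alpha x y <= hdefect alpha (s * x) (s * y).
Proof.
move=> al0 x0 /andP[s0 s1] alr rw.
apply: hdefect_le; rewrite ?mulr_gt0 //.
have r0 : 0 <= r by apply: le_trans alr; exact: cmod_ge0.
have := cmod_sqr alpha; have := cmod_sqr (x +i* y) => /= E1 E2.
have h1 : cmod alpha ^+ 2 <= s * cmod (x +i* y) ^+ 2.
  have : cmod alpha ^+ 2 <= (s * cmod (x +i* y)) ^+ 2.
    by rewrite ler_pXn2r ?nnegrE ?mulr_ge0 ?cmod_ge0 ?(ltW s0) // (le_trans alr).
  move/le_trans; apply; rewrite exprMn ler_wpM2r ?sqr_ge0 //.
  by rewrite expr2 ler_piMl // ltW.
rewrite E1 E2 in h1.
have h2 : 0 <= (1 - s) * (s * (x ^+ 2 + y ^+ 2) - (complex.Re alpha ^+ 2 + complex.Im alpha ^+ 2)).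
  by rewrite mulr_ge0 // subr_ge0.
by have := mulr_ge0 (ltW x0) h2; lra.
Qed.

(** With [y] fixed the defect increases in [x] as long as [x] is at most
    the distance from [i y] to [alpha]; for [alpha] in the cone
    [|v| <= C u], this distance is at least [|y| / (1 + C)]. *)
Lemma hdefect_horizontal alpha x x' y C : 0 < complex.Re alpha -> 0 < x ->
  x <= x' -> 0 <= C -> `|complex.Im alpha| <= C * complex.Re alpha ->
  (1 + C) * x' <= `|y| ->
  hdefect alpha x y <= hdefect alpha x' y.
Proof.
move=> al0 x0 xx' C0 cone hy.
have x'0 : 0 < x' by exact: lt_le_trans xx'.
apply: hdefect_le => //.
set u := complex.Re alpha in al0 cone *; set v := complex.Im alpha in cone *.
have y1 : `|y| <= `|y - v| + C * u.
  by apply: le_trans (lerD (lexx _) cone); rewrite -{1}(subrK v y) ler_normD.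
have b0 := normr_ge0 (y - v).
have E : (y - v) ^+ 2 = `|y - v| ^+ 2 by rewrite real_normK ?num_real.
have hx : (1 + C) ^+ 2 * x' ^+ 2 <= (1 + C) ^+ 2 * (u ^+ 2 + (y - v) ^+ 2).
  rewrite E; set b := `|y - v| in y1 b0 *.
  have h1 : (1 + C) * x' <= b + C * u by exact: le_trans y1.
  have h2 : ((1 + C) * x') ^+ 2 <= (b + C * u) ^+ 2.
    by rewrite ler_pXn2r ?nnegrE ?mulr_ge0 ?addr_ge0 ?mulr_ge0 // ltW.
  have h3 : 0 <= (C * b - u) ^+ 2 by exact: sqr_ge0.
  have h4 : 0 <= C * (b ^+ 2 + u ^+ 2) by rewrite mulr_ge0 // addr_ge0 ?sqr_ge0.
  rewrite exprMn in h2; apply: (le_trans h2); lra.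
have hx2 : x' ^+ 2 <= u ^+ 2 + (y - v) ^+ 2.
  by move: hx; rewrite ler_pM2l // exprn_gt0 // ltr_pwDl.
have hx3 : x * x' <= u ^+ 2 + (y - v) ^+ 2.
  by apply: le_trans hx2; rewrite expr2 ler_wpM2r // ltW.
have : 0 <= (x' - x) * (u ^+ 2 + (y - v) ^+ 2 - x * x').
  by rewrite mulr_ge0 // subr_ge0.
lra.
Qed.

End HalfPlane.

(** * Blaschke products in half-plane coordinates *)

Section Defects.
Variables (R : realType) (a : nat -> R[i]) (xi : R[i]).
Hypothesis a_disc : forall n, unit_disc (a n).
Hypothesis a_neq0 : forall n, a n != 0.
Hypothesis a_blaschke : (\sum_(n <oo) (1 - cmod (a n))%:E < +oo)%E.
Hypothesis xi1 : cmod xi = 1.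

Definition zero_coord k : R[i] := cayley (Num.conj xi * a k).

Definition hp_point (x y : R) : R[i] := xi * cayley (x +i* y).

Lemma mul_conj_unimodular : xi * Num.conj xi = 1.
Proof. by rewrite -sqr_cmodC xi1 rmorph1 expr1n. Qed.

Lemma rotate_lt1 z : cmod z < 1 -> cmod (Num.conj xi * z) < 1.
Proof. by rewrite cmodM cmodJ xi1 mul1r. Qed.

Lemma hp_pointK z : cmod z < 1 ->
  exists x y, [/\ 0 < x & z = hp_point x y].
Proof.
move=> /rotate_lt1 z1; have := Re_cayley_gt0 z1.
case E : (cayley (Num.conj xi * z)) => [x y] x0; exists x, y; split => //.
by rewrite /hp_point -E cayleyK ?disc_one_add_neq0 // mulrA mul_conj_unimodular mul1r.
Qed.

Lemma hp_point_disc x y : 0 < x -> unit_disc (hp_point x y).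
Proof. by move=> x0; rewrite /unit_disc /= cmodM xi1 mul1r cmod_cayley_lt1. Qed.

Lemma zero_coordK k : a k = xi * cayley (zero_coord k).
Proof.
have h := rotate_lt1 (a_disc k).
by rewrite /zero_coord cayleyK ?disc_one_add_neq0 // mulrA mul_conj_unimodular mul1r.
Qed.

Lemma Re_zero_coord_gt0 k : 0 < complex.Re (zero_coord k).
Proof. exact: Re_cayley_gt0 (rotate_lt1 (a_disc k)). Qed.

Let defect k x y := hdefect (zero_coord k) x y.

Lemma cmod_factor_hp k x y : 0 < x ->
  cmod (blaschke_factor (a k) (hp_point x y)) ^+ 2 = 1 - defect k x y.
Proof.
move=> x0; rewrite [in LHS]zero_coordK cmod_blaschke_factor_cayley //.
  exact: Re_zero_coord_gt0.
by rewrite -zero_coordK.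
Qed.

Lemma defect_ge0 k x y : 0 < x -> 0 <= defect k x y.
Proof. by move=> x0; apply: hdefect_ge0 => //; exact: Re_zero_coord_gt0. Qed.

(** The comparison is factor by factor, so it says that a move that approaches
    every zero decreases the modulus. *)
Lemma blaschke_product_mono x y x' y' : 0 < x -> 0 < x' ->
  (forall k, defect k x y <= defect k x' y') ->
  cmod (blaschke_product a (hp_point x' y')) <=
  cmod (blaschke_product a (hp_point x y)).
Proof.
move=> x0 x'0 le_defect.
have le_prod n : cmod (\prod_(k < n) blaschke_factor (a k) (hp_point x' y')) <=
                 cmod (\prod_(k < n) blaschke_factor (a k) (hp_point x y)).
  elim: n => [|n IHn]; first by rewrite !big_ord0.
  rewrite !big_ord_recr /= [leLHS]cmodM [leRHS]cmodM ler_pM ?cmod_ge0 //.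
  by rewrite -(@ler_pXn2r _ 2) ?nnegrE ?cmod_ge0 // !cmod_factor_hp // lerD2l lerN2.
have /cvgn_cmodP lim := blaschke_product_cvg a_disc a_neq0 a_blaschke (hp_point_disc y x0).
have /cvgn_cmodP lim' := blaschke_product_cvg a_disc a_neq0 a_blaschke (hp_point_disc y' x'0).
apply/ler_addgt0Pr => e e0.
have [N hN] := lim (e / 2) (divr_gt0 e0 (ltr0Sn _ 1)).
have [N' hN'] := lim' (e / 2) (divr_gt0 e0 (ltr0Sn _ 1)).
have := hN (maxn N N') (leq_maxl _ _); have := hN' (maxn N N') (leq_maxr _ _).
have := le_prod (maxn N N').
set p' := \prod_(k < _) blaschke_factor (a k) (hp_point x' y').
set p := \prod_(k < _) blaschke_factor (a k) (hp_point x y).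
have := lerB_cmod (blaschke_product a (hp_point x' y')) p'.
have := lerB_cmod p (blaschke_product a (hp_point x y)).
rewrite [cmod (p - _)]cmodBC; lra.
Qed.

(** For [t k >= 0] the product of the [1 - t k] is at most [1 / (1 + s)], where
    [s] is the sum of the [t k], by induction from [(1 - t) (1 + s + t) <= 1 + s];
    and [|B|] is at most the modulus of each partial product. *)
Lemma blaschke_product_defect_bound n x y : 0 < x ->
  cmod (blaschke_product a (hp_point x y)) ^+ 2 *
    (1 + \sum_(k < n) defect k x y) <= 1.
Proof.
move=> x0; have z1 := hp_point_disc y x0.
pose p m := \prod_(k < m) blaschke_factor (a k) (hp_point x y).
have sum_ge0 m : 0 <= \sum_(k < m) defect k x y by apply: sumr_ge0 => k _; exact: defect_ge0.
have pn m : cmod (p m) ^+ 2 * (1 + \sum_(k < m) defect k x y) <= 1.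
  rewrite /p; elim: m => [|m IHm]; first by rewrite !big_ord0 cmod1 expr1n addr0 mulr1.
  apply: le_trans IHm; rewrite !big_ord_recr /= cmodM exprMn cmod_factor_hp //.
  rewrite -mulrA ler_wpM2l ?sqr_ge0 //.
  have := sum_ge0 m; have := defect_ge0 m y x0.
  move: (defect m x y) (\sum_(k < m) _) => t s t0 s0.
  by have := mulr_ge0 t0 s0; have := sqr_ge0 t; lra.
have Bp : cmod (blaschke_product a (hp_point x y)) <= cmod (p n).
  rewrite -[X in cmod X]subr0.
  apply: (cmod_lim_le (N := n) (blaschke_product_cvg a_disc a_neq0 a_blaschke z1)) => m.
  move=> /subnK <-; rewrite subr0; elim: (m - n)%N => [|d IHd]; first by rewrite add0n.
  rewrite addSn big_ord_recr cmodM -[leRHS]mulr1 ler_pM ?cmod_ge0 //.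
  exact: cmod_blaschke_factor_le1 (a_disc _) (ltW z1).
apply: le_trans (pn n); rewrite ler_wpM2r ?addr_ge0 //.
by rewrite ler_pXn2r ?nnegrE ?cmod_ge0.
Qed.

(** Segments are taken in half-plane coordinates, where all the walks of the
    connectedness argument are straight. *)
Lemma connected_component_segment (eps : R) x0 y0 x1 y1 : 0 < x0 -> 0 < x1 ->
  (forall t, 0 <= t <= 1 -> cmod (blaschke_product a
     (hp_point (x0 + t * (x1 - x0)) (y0 + t * (y1 - y0)))) < eps) ->
  connected_component (level_set (blaschke_product a) eps)
    (hp_point x0 y0) (hp_point x1 y1).
Proof.
move=> x00 x10 Beps.
have pos t : 0 <= t <= 1 -> 0 < x0 + t * (x1 - x0).
  move=> /andP[t0 t1]; have := mulr_ge0 t0 (ltW x10).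
  have : 0 <= (1 - t) * x0 by rewrite mulr_ge0 ?subr_ge0 // ltW.
  have [->|tn0] := eqVneq t 0; first by lra.
  have : 0 < t * x1 by rewrite mulr_gt0 // lt_neqAle eq_sym tn0.
  lra.
pose g t : R[i]^o := hp_point (x0 + t * (x1 - x0)) (y0 + t * (y1 - y0)).
rewrite (_ : hp_point x0 y0 = g 0); last by rewrite /g !mul0r !addr0.
rewrite (_ : hp_point x1 y1 = g 1); last by rewrite /g !mul1r ![_ + (_ - _)]addrC !subrK.
apply: (@connected_component_path _ _ g (2 * cmod ((x1 - x0) +i* (y1 - y0)))).
  move=> s t s01 t01; rewrite /g /hp_point -mulrBr cmodM xi1 mul1r.
  apply: (le_trans (cayley_lipschitz _ _)).
  - exact: ltW (pos s s01).
  - exact: ltW (pos t t01).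
  rewrite -mulrA ler_wpM2l // -cmod_real mulrC -cmodM le_eqVlt; apply/orP; left.
  by apply/eqP; congr (cmod _); apply/eqP; rewrite eq_complex /=; apply/andP; split; apply/eqP; ring.
by move=> t t01; split; [exact: hp_point_disc (pos t t01)|exact: Beps].
Qed.

End Defects.

(** * Tails of the zero sequence *)

Section Tails.
Variables (R : realType) (a : nat -> R[i]).
Hypothesis a_disc : forall n, unit_disc (a n).

Let e_gt0 k : 0 < 1 - cmod (a k).
Proof. by rewrite subr_gt0; exact: a_disc. Qed.

(** Halving a positive lower bound of the ratios makes room for replacing the
    infinite tail by a finite part of it. *)
Lemma tail_ratio_partial_sum : (0 < limn_einf (tail_ratio a))%E ->
  exists (c : R) (N : nat), 0 < c /\ forall n, (N <= n)%N -> exists m,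
    c * (1 - cmod (a n)) <=
    \sum_(j < m | cmod (a n) < cmod (a j)) (1 - cmod (a j)).
Proof.
rewrite limn_einf_lim (cvg_lim _ (@cvg_einfs_sup _ _)) //.
move=> /ereal_sup_gt[_ [N _ <-]] infN.
have [c c0 cN] : exists2 c : R, 0 < c & (c%:E <= einfs (tail_ratio a) N)%E.
  case: (einfs (tail_ratio a) N) infN => [r|_|//]; first by exists r.
  by exists 1; rewrite ?leey.
exists (c / 2), N; split=> [|n Nn]; first by rewrite divr_gt0.
have cn : (c%:E <= tail_ratio a n)%E.
  by apply: (le_trans cN); apply: ereal_inf_lbound; exists n.
rewrite /tail_ratio inver gt_eqF ?e_gt0 // lee_pdivlMr ?e_gt0 // in cn.
apply: contrapT => /forallNP small.
have : (\sum_(j <oo | (cmod (a n) < cmod (a j))%R) (1 - cmod (a j))%:E <=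
        (c / 2 * (1 - cmod (a n)))%:E)%E.
  apply: lime_le.
    by apply: is_cvg_nneseries_cond => k _ _; rewrite lee_fin ltW ?e_gt0.
  near=> m; rewrite sumEFin lee_fin big_mkord leNgt.
  by apply/negP => /ltW; exact: small.
move/(le_trans cn); rewrite -EFinM lee_fin ler_pM2r ?e_gt0 //.
by move: c0; lra.
Unshelve. all: by end_near. Qed.

Lemma blaschke_tail_small :
  (\sum_(n <oo) (1 - cmod (a n))%:E < +oo)%E ->
  forall d : R, 0 < d -> exists n, 1 - cmod (a n) < d.
Proof.
move=> a_blaschke d d0; have [S aS] := blaschke_sum_bound a_disc a_blaschke.
apply: contrapT => /forallNP big_e.
have sum_ge n : n%:R * d <= \sum_(k < n) (1 - cmod (a k)).
  elim: n => [|n IHn]; first by rewrite mul0r big_ord0.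
  rewrite big_ord_recr /= -natr1 mulrDl mul1r lerD // leNgt.
  exact/negP/big_e.
have := truncnS_gt (S / d); rewrite ltr_pdivrMr //.
by have := sum_ge (Num.truncn (S / d)).+1; have := aS (Num.truncn (S / d)).+1; lra.
Qed.

End Tails.

(** * Connectedness of a level set *)

Section LevelSet.
Variables (R : realType) (a : nat -> R[i]) (xi : R[i]) (C : R).
Hypothesis a_disc : forall n, unit_disc (a n).
Hypothesis a_neq0 : forall n, a n != 0.
Hypothesis a_nondecr : forall m n, (m <= n)%N -> cmod (a m) <= cmod (a n).
Hypothesis a_blaschke : (\sum_(n <oo) (1 - cmod (a n))%:E < +oo)%E.
Hypotheses (xi1 : cmod xi = 1) (C1 : 1 < C).
Hypothesis a_stolz : forall n, stolz_domain xi C (a n).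
Hypothesis a_liminf : (0 < limn_einf (tail_ratio a))%E.

Let alpha := zero_coord a xi.
Let rad : R := C * (C + 1) / 2.
Let e k := 1 - cmod (a k).

Let C0 : 0 < C. Proof. by have := C1; lra. Qed.

Let rad_gt0 : 0 < rad.
Proof. by rewrite divr_gt0 // mulr_gt0 // addr_gt0. Qed.

Let e_gt0 k : 0 < e k. Proof. by rewrite subr_gt0; exact: a_disc. Qed.

(** The Stolz condition keeps [1 + conj xi (a k)] away from 0, namely
    [2 <= (C + 1) |1 + conj xi (a k)|]; this is where the constant [rad] comes
    from. So in the half-plane the zeros lie in a cone, at a height comparable to
    [1 - |a k|]. *)
Lemma zero_coord_stolz k :
  [/\ cmod (alpha k) <= rad * e k, e k / 4 <= complex.Re (alpha k)
    & cmod (alpha k) <= C * complex.Re (alpha k)].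
Proof.
set z := Num.conj xi * a k.
have zk : cmod z = cmod (a k) by rewrite cmodM cmodJ xi1 mul1r.
have z1 : cmod z < 1 by rewrite zk; exact: a_disc.
have n1 := disc_one_add_neq0 z1; have n2 := cayleyD1_neq0 n1.
have [_ stolz] := a_stolz k; rewrite -/z -zk in stolz.
have N0 : 0 < cmod (1 + z) by rewrite cmod_gt0.
have alE : cmod (alpha k) = cmod (1 - z) / cmod (1 + z).
  by rewrite /alpha /zero_coord -/z /cayley cmodM cmodV.
have ReE : complex.Re (alpha k) = (1 - cmod z ^+ 2) / cmod (1 + z) ^+ 2.
  have := one_sub_cmod_cayley_sqr n2; rewrite cayleyK // -/(zero_coord a xi k) -/(alpha k).
  rewrite (_ : 1 + cayley z = 2 / (1 + z)); last by rewrite /cayley; field.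
  move=> ->; rewrite cmodM cmodV.
  by rewrite cmod2 /alpha /zero_coord -/z; field; rewrite gt_eqF.
have z0 := cmod_ge0 z.
have N2 : cmod (1 + z) <= 1 + cmod z by have := cmodD 1 z; rewrite cmod1.
have eE : e k = 1 - cmod z by rewrite zk.
have N1 : 1 - cmod z <= cmod (1 + z).
  by have := lerB_cmod 1 (- z); rewrite cmod1 cmodN opprK.
have N3 : 2 - cmod (1 - z) <= cmod (1 + z).
  have := cmodD (1 + z) (1 - z); rewrite (_ : 1 + z + (1 - z) = 2); last by ring.
  by rewrite cmod2; lra.
have N4 : 2 <= (C + 1) * cmod (1 + z).
  by have := ler_wpM2l (ltW C0) N1; lra.
split.
- rewrite alE ler_pdivrMr // eE; apply: (le_trans stolz).
  have := ler_wpM2l (mulr_ge0 (ltW C0) (ltW (e_gt0 k))) N4.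
  by rewrite eE /rad; lra.
- rewrite ReE ler_pdivlMr ?exprn_gt0 // eE.
  have h : cmod (1 + z) ^+ 2 <= (1 + cmod z) ^+ 2.
    by rewrite ler_pXn2r ?nnegrE ?cmod_ge0 // addr_ge0.
  have h' : 0 <= 1 - cmod z by rewrite subr_ge0 ltW.
  have := ler_wpM2l h' h; have := mulr_ge0 h' (mulr_ge0 h' z0).
  have := mulr_ge0 h' h'; have := mulr_ge0 h' z0; nra.
- rewrite alE ReE mulrA ler_pdivrMr // mulrAC ler_pdivlMr ?exprn_gt0 //.
  rewrite expr2 mulrA ler_wpM2r ?cmod_ge0 //.
  have h := ler_pM (cmod_ge0 _) (cmod_ge0 _) stolz N2.
  by apply: (le_trans h); lra.
Qed.

Let alpha_gt0 k : 0 < complex.Re (alpha k).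
Proof. exact: Re_zero_coord_gt0. Qed.

Let alpha_le_rad k : cmod (alpha k) <= rad.
Proof.
have [h _ _] := zero_coord_stolz k; apply: (le_trans h).
by rewrite ler_piMr ?(ltW rad_gt0) // /e lerBlDr lerDl cmod_ge0.
Qed.

(** The zeros satisfy [|v| <= C u]; the wider opening [1 + C] is the one at which
    the horizontal walks of [hdefect_horizontal] may stop. The cone must
    be truncated, for [|B|] tends to 1 at infinity. *)
Definition core (x y : R) := [/\ 0 < x, x <= rad & `|y| <= (1 + C) * x].

(** At height [x] take the last zero [a n] with [1 - |a n| >= kappa x]. By the
    tail hypothesis the zeros of larger modulus carry a mass at least
    [c kappa x]; they satisfy [|alpha j| <= x], so each of them has a defect at
    least [(1 - |a j|) / (D x)]. The choice of [kappa] makes [n] at least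
    the rank [N] from which the tail hypothesis is effective. *)
Lemma core_defect_bound : exists2 tau : R, 0 < tau & forall x y, core x y ->
  exists m, tau <= \sum_(j < m) hdefect (alpha j) x y.
Proof.
have [c [N [c0 tail]]] := tail_ratio_partial_sum a_disc a_liminf.
pose kappa := e N / rad; pose D := 4 + (2 + C) ^+ 2.
have kappa0 : 0 < kappa by rewrite divr_gt0.
have D0 : 0 < D by rewrite ltr_pwDl // sqr_ge0.
exists (c * kappa / D); first by rewrite !mulr_gt0 ?invr_gt0.
move=> x y [x0 xrad ycone].
have eN : kappa * x <= e N.
  by rewrite /kappa mulrAC ler_pdivrMr // ler_wpM2l // ltW.
have e_mono i j : (i <= j)%N -> e j <= e i by move=> ij; rewrite lerD2l lerN2 a_nondecr.
(* The last zero before the bound is the predecessor of the first one after. *)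
have [/= M eM minM] := ex_minnP (blaschke_tail_small a_disc a_blaschke (mulr_gt0 kappa0 x0)).
have NM : (N < M)%N.
  rewrite ltnNge; apply/negP => /e_mono; rewrite leNgt => /negP; apply.
  exact: lt_le_trans eN.
case: M eM minM NM => // n en minn Nn.
have en' : kappa * x <= e n.
  by rewrite leNgt; apply/negP => /minn; rewrite ltnn.
have [m tailn] := tail n Nn; exists m.
have defect_ge j : cmod (a n) < cmod (a j) -> e j / (D * x) <= hdefect (alpha j) x y.
  move=> nj; have nj' : (n < j)%N.
    by rewrite ltnNge; apply/negP => /a_nondecr; rewrite leNgt nj.
  have ej : e j <= kappa * x by apply: le_trans (e_mono _ _ nj') _; exact: ltW.
  have [h1 h2 _] := zero_coord_stolz j.
  have e1 : e N <= 1 by rewrite lerBlDr lerDl cmod_ge0.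
  have al_x : cmod (alpha j) <= x.
    apply: (le_trans h1); apply: (le_trans (ler_wpM2l (ltW rad_gt0) ej)).
    rewrite /kappa (_ : rad * (e N / rad * x) = e N * x); last by field; rewrite gt_eqF.
    by rewrite ler_piMl // ltW.
  have u0 := alpha_gt0 j.
  have ux : complex.Re (alpha j) <= x.
    by apply: le_trans al_x; apply: le_trans (Re_le_cmod _); exact: ler_norm.
  have vx : `|complex.Im (alpha j)| <= x.
    by apply: le_trans al_x; exact: Im_le_cmod.
  have yv : `|y - complex.Im (alpha j)| <= (2 + C) * x.
    by apply: (le_trans (ler_normB _ _)); have := lerD ycone vx; lra.
  have den : (x + complex.Re (alpha j)) ^+ 2 + (y - complex.Im (alpha j)) ^+ 2 <= D * x ^+ 2.
    rewrite /D mulrDl -exprMn; apply: lerD.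
      rewrite (_ : 4 * x ^+ 2 = (2 * x) ^+ 2); last by ring.
      by rewrite ler_pXn2r ?nnegrE //; lra.
    rewrite -(real_normK (num_real (y - _))).
    by rewrite ler_pXn2r ?nnegrE ?mulr_ge0 ?addr_ge0 ?(ltW x0) ?(ltW C0).
  rewrite /hdefect ler_pdivrMr ?mulr_gt0 // mulrAC ler_pdivlMr; last first.
    by rewrite ltr_pwDl ?sqr_ge0 // exprn_gt0 // addr_gt0.
  apply: (le_trans (ler_wpM2l (ltW (e_gt0 j)) den)).
  have := ler_wpM2l (mulr_ge0 (ltW D0) (sqr_ge0 x)) h2; lra.
have nn j : 0 <= hdefect (alpha j) x y by apply: hdefect_ge0.
rewrite (bigID (fun j : 'I_m => cmod (a n) < cmod (a j))) /=.
apply: (@le_trans _ _ (\sum_(j < m | cmod (a n) < cmod (a j)) hdefect (alpha j) x y)); last first.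
  by rewrite lerDl sumr_ge0.
apply: (@le_trans _ _ (\sum_(j < m | cmod (a n) < cmod (a j)) (e j / (D * x)))); last first.
  by apply: ler_sum => j nj; exact: defect_ge.
rewrite -mulr_suml ler_pdivlMr ?mulr_gt0 //.
apply: le_trans tailn.
rewrite (_ : c * kappa / D * (D * x) = c * (kappa * x)); last by field; rewrite gt_eqF.
by rewrite ler_pM2l.
Qed.

(** Any [eps] with [1 / (1 + tau) < eps ^ 2 < 1] works. *)
Lemma connected_level_set :
  exists eps : R, 0 < eps < 1 /\ connected (level_set (blaschke_product a) eps).
Proof.
have [tau tau0 core_tau] := core_defect_bound.
pose q := (1 + tau / 2)^-1.
have q0 : 0 < q by rewrite invr_gt0; lra.
have q1 : q < 1 by rewrite invf_lt1 //; lra.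
exists (Num.sqrt q); split.
  by rewrite sqrtr_gt0 q0 /= -[ltRHS]sqrtr1 ltr_sqrt.
set eps := Num.sqrt q; set L := level_set _ _.
have eps0 : 0 <= eps by exact: sqrtr_ge0.
have core_small x y : core x y -> cmod (blaschke_product a (hp_point xi x y)) < eps.
  move=> xy; have [m mtau] := core_tau x y xy; have [x0 _ _] := xy.
  have B1 := blaschke_product_defect_bound a_disc a_neq0 a_blaschke xi1 m y x0.
  rewrite -(@ltr_pXn2r _ 2) ?nnegrE ?cmod_ge0 // sqr_sqrtr ?(ltW q0) //.
  rewrite /q -[ltRHS]mul1r ltr_pdivlMr; last by lra.
  have [->|Bn0] := eqVneq (cmod (blaschke_product a (hp_point xi x y)) ^+ 2) 0.
    by rewrite mul0r.
  apply: lt_le_trans B1; rewrite ltr_pM2l ?lt_def ?Bn0 ?sqr_ge0 //.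
  by rewrite -/alpha; lra.
have core_rad : core rad 0 by rewrite /core rad_gt0 lexx normr0 mulr_ge0 ?addr_ge0 ?ltW.
apply: (@connected_hub _ _ (hp_point xi rad 0)) => z [/(hp_pointK xi1)[x [y [x0 ->]]] Bz].
have core_hub u v : core u v -> connected_component L (hp_point xi u v) (hp_point xi rad 0).
  move=> [u0 urad vcone]; apply: connected_component_segment => // t /andP[t0 t1].
  apply: core_small.
  have h1 : 0 <= t * (rad - u) by rewrite mulr_ge0 // subr_ge0.
  have h2 : 0 <= (1 - t) * (rad - u) by rewrite mulr_ge0 // subr_ge0.
  split; [lra|lra|].
  rewrite (_ : v + t * (0 - v) = (1 - t) * v); last by ring.
  rewrite normrM ger0_norm ?subr_ge0 //.
  have := ler_wpM2l (_ : 0 <= 1 - t) vcone; rewrite subr_ge0 => /(_ t1) h3.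
  apply: (le_trans h3); have := mulr_ge0 (ltW C0) h1.
  have := mulr_ge0 t0 (ltW u0); have := mulr_ge0 (ltW C0) (mulr_ge0 t0 (ltW u0)).
  lra.
have inner_hub u v : 0 < u -> cmod (u +i* v) <= rad ->
    cmod (blaschke_product a (hp_point xi u v)) < eps ->
    connected_component L (hp_point xi u v) (hp_point xi rad 0).
  move=> u0 uvrad Buv.
  have [vcone|vcone] := leP `|v| ((1 + C) * u).
    apply: core_hub; split=> //.
    by apply: le_trans uvrad; apply: le_trans (Re_le_cmod _); exact: ler_norm.
  have D0 : 0 < 1 + C by rewrite addr_gt0.
  pose u' := `|v| / (1 + C).
  have u'v : (1 + C) * u' = `|v| by rewrite /u'; field; rewrite gt_eqF.
  have uu' : u < u' by rewrite ltr_pdivlMr // mulrC.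
  have u'0 : 0 < u' by exact: lt_trans uu'.
  apply: (@connected_component_trans R[i]^o L (hp_point xi u' v)); last first.
    apply: core_hub; split=> //; last by rewrite u'v.
    apply: (@le_trans _ _ `|v|); last by apply: le_trans uvrad; exact: (Im_le_cmod (u +i* v)).
    by rewrite ler_pdivrMr // ler_peMr // lerDl ltW.
  apply: connected_component_segment => // t /andP[t0 t1]; rewrite subrr mulr0 addr0.
  have h1 : 0 <= t * (u' - u) by rewrite mulr_ge0 // subr_ge0 ltW.
  have h2 : 0 <= (1 - t) * (u' - u) by rewrite mulr_ge0 ?subr_ge0 // ltW.
  apply: le_lt_trans Buv.
  apply: (blaschke_product_mono a_disc a_neq0 a_blaschke xi1) => //; first lra.
  move=> k; have [_ _ cone] := zero_coord_stolz k.
  apply: (hdefect_horizontal (C := C)) => //.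
  - by lra.
  - exact: ltW.
  - by apply: le_trans cone; exact: Im_le_cmod.
  - by rewrite -u'v ler_pM2l //; lra.
have [xyrad|xyrad] := leP (cmod (x +i* y)) rad; first exact: inner_hub.
have m0 : 0 < cmod (x +i* y) by exact: lt_trans xyrad.
pose s := rad / cmod (x +i* y).
have s0 : 0 < s by rewrite divr_gt0.
have s1 : s < 1 by rewrite ltr_pdivrMr // mul1r.
have srad : s * cmod (x +i* y) = rad by rewrite /s; field; rewrite gt_eqF.
have Bs t : s <= t <= 1 -> cmod (blaschke_product a (hp_point xi (t * x) (t * y))) < eps.
  move=> /andP[st t1]; have t0 : 0 < t by exact: lt_le_trans st.
  apply: le_lt_trans Bz.
  apply: (blaschke_product_mono a_disc a_neq0 a_blaschke xi1) => //; first exact: mulr_gt0.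
  move=> k; apply: (hdefect_scale (r := rad)) => //; first by rewrite t0.
  by rewrite -srad ler_wpM2r // ltW.
apply: (@connected_component_trans R[i]^o L (hp_point xi (s * x) (s * y))); last first.
  apply: inner_hub; [exact: mulr_gt0| |by apply: Bs; rewrite lexx ltW].
  rewrite (_ : (s * x) +i* (s * y) = s%:C * (x +i* y)); last by simpc.
  by rewrite cmodM cmod_real gtr0_norm // srad.
apply: connected_component_segment => //; first exact: mulr_gt0.
move=> t /andP[t0 t1].
rewrite (_ : x + t * (s * x - x) = (1 - t * (1 - s)) * x); last by ring.
rewrite (_ : y + t * (s * y - y) = (1 - t * (1 - s)) * y); last by ring.
apply: Bs.
have h1 : 0 <= t * (1 - s) by rewrite mulr_ge0 // subr_ge0 ltW.
have h2 : 0 <= (1 - t) * (1 - s) by rewrite mulr_ge0 // subr_ge0 // ltW.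
by apply/andP; split; lra.
Qed.

End LevelSet.

Theorem theorem1 (R : realType) (a : nat -> R[i])
  (a_disc : forall n, unit_disc (a n))
  (a_neq0 : forall n, a n != 0)
  (a_nondecr : forall m n, (m <= n)%N -> cmod (a m) <= cmod (a n))
  (a_blaschke : (\sum_(n <oo) (1 - cmod (a n))%:E < +oo)%E)
  (a_stolz : exists (xi : R[i]) (C : R),
     [/\ cmod xi = 1, 1 < C & forall n, stolz_domain xi C (a n)])
  (a_liminf : (0 < limn_einf (tail_ratio a))%E) :
  one_component_inner (blaschke_product a).
Proof.
have [xi [C [xi1 C1 stolz]]] := a_stolz; split.
  exact: (blaschke_product_inner a_disc a_neq0 a_blaschke xi1 C1 stolz).
exact: (connected_level_set a_disc a_neq0 a_nondecr a_blaschke xi1 C1 stolz a_liminf).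
Qed.
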